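(* For each integer $m\ge 2$, let $K_m=K_{m^{<\omega}}$ denote the compact space associated to the branches of the $m$-adic tree $m^{<\omega}$. Then the spaces $K_m$, $m\ge 2$, are pairwise non-homeomorphic. Furthermore, if $2\le n<m$ then there is no continuous surjection from $K_n$ onto $K_m$.
   Context: $m^{<\omega}$ is the set of all finite sequences with entries in $\{0,\dots,m-1\}$, ordered by end-extension $\preceq$. For $x\in m^\omega$, the branch is $B(x)=\{x|n:n\in\omega\}\subseteq m^{<\omega}$, the set of all finite initial segments of $x$. The family of all $B(x)$ is an almost disjoint family (a family of infinite sets any two distinct members of which have finite intersection). Let $\psi=m^{<\omega}\cup m^\omega$ be the topological space in which every element of $m^{<\omega}$ is isolated and, for $x\in m^\omega$, the sets $\{x\}\cup (B(x)\setminus F)$, $F$ finite, form a local base at $x$. This is a locally compact Hausdorff space, and $K_m=\psi\cup\{\infty\}$ is its one-point compactification. *)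

(* Defs.v *)
From HB Require Import structures.
From mathcomp Require Import all_boot all_order.
From mathcomp Require Import all_classical.
From mathcomp Require Import topology.

Set Implicit Arguments.
Unset Strict Implicit.
Unset Printing Implicit Defensive.

Local Open Scope classical_set_scope.

(* [mkseq x n] is the initial segment x|n = (x 0, ..., x (n-1)). *)
Definition branch (m : nat) (x : nat -> 'I_m) : set (seq 'I_m) :=
  [set mkseq x n | n in [set: nat]].

(* The space m^{<omega} U m^omega as a disjoint union of its isolated points
   (nodes of the tree) and its points at the end of the branches. *)
Inductive psi (m : nat) : Type :=
| Node of seq 'I_m
| Branch of (nat -> 'I_m).

Arguments Node {m}.
Arguments Branch {m}.

HB.instance Definition _ (m : nat) := gen_eqMixin (psi m).
HB.instance Definition _ (m : nat) := gen_choiceMixin (psi m).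

Definition psi_nbhs (m : nat) (p : psi m) : set_system (psi m) :=
  match p with
  | Node s => principal_filter (Node s)
  | Branch x =>
      filter_from (@finite_set (seq 'I_m))
        (fun F => [set Branch x] `|` (Node @` (branch x `\` F)))
  end.

Arguments psi_nbhs {m}.

Lemma psi_nbhs_filter (m : nat) (p : psi m) : ProperFilter (psi_nbhs p).
Proof.
case: p => [s|x] /=; first exact: principal_filter_proper.
apply: filter_from_proper; last by move=> F _; exists (Branch x); left.
apply: filter_from_filter; first by exists set0; exact: finite_set0.
move=> F G finF finG; exists (F `|` G); first by rewrite finite_setU.
move=> q [->|[s [Bs /not_orP[Fs Gs]] <-]]; first by split; left.
by split; right; exists s.
Qed.

Lemma psi_nbhs_singleton (m : nat) (p : psi m) (A : set (psi m)) :
  psi_nbhs p A -> A p.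
Proof.
case: p => [s|x] /=; first by move/principal_filterP.
by case=> F _; apply; left.
Qed.

Lemma psi_nbhs_nbhs (m : nat) (p : psi m) (A : set (psi m)) :
  psi_nbhs p A -> psi_nbhs p (psi_nbhs^~ A).
Proof.
case: p => [s|x] /=; first by move=> ?; exact/principal_filterP.
case=> F finF FA; exists F => // q [->|[s Fs <-]] /=; first by exists F.
by apply/principal_filterP/FA; right; exists s.
Qed.

HB.instance Definition _ (m : nat) := hasNbhs.Build (psi m) (@psi_nbhs m).

HB.instance Definition _ (m : nat) := @Nbhs_isNbhsTopological.Build (psi m)
  (@psi_nbhs_filter m) (@psi_nbhs_singleton m) (@psi_nbhs_nbhs m).

Definition K (m : nat) : topologicalType := one_point_compactification (psi m).

Definition homeomorphic (X Y : topologicalType) : Prop :=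
  exists (f : X -> Y) (g : Y -> X),
    [/\ continuous f, continuous g, cancel f g & cancel g f].

(* Main.v *)
Require Import Defs.
From mathcomp Require Import all_boot all_order.
From mathcomp Require Import all_classical.
From mathcomp Require Import topology.

Local Open Scope classical_set_scope.

(** Let f : K_n -> K_m be a continuous surjection. For all but countably many x,
    some branch point z is mapped to x. Fix a neighbourhood U_x = {x} U {x|k : k >= l}
    of x missing f(oo). As its preimage is a compact clopen subset of psi_n, there is a
    node r on z above which the nodes mapped into U_x are exactly those of B(z). By the
    Baire category theorem, r and l can be taken constant for x in a set Y which is dense
    in a cone [s]. For i < m choose x_i in Y extending s^i, and a corresponding z_i. The
    nodes t above r such that f(t) is below s and of length >= l lie on all the z_i and
    are finitely many; let t be the longest one. If n < m, two of the z_i pass through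
    the same successor t^a, so f(t^a) is on both x_i, hence below s, and t was not
    maximal. *)

Set Implicit Arguments.
Unset Strict Implicit.
Unset Printing Implicit Defensive.

Lemma branchE {m} (x : nat -> 'I_m) s : branch x s <-> mkseq x (size s) = s.
Proof.
by split=> [[k _ <-]|<-]; [rewrite size_mkseq | exists (size s)].
Qed.

Lemma branch_mkseq {m} (x : nat -> 'I_m) k : branch x (mkseq x k).
Proof. by exists k. Qed.

Lemma prefix_mkseq {T : eqType} (x : nat -> T) j k :
  j <= k -> prefix (mkseq x j) (mkseq x k).
Proof.
move=> jk; rewrite prefixE size_mkseq /mkseq -map_take take_iota.
by move/minn_idPl: jk => ->.
Qed.

Lemma branch_prefix {m} (x : nat -> 'I_m) s t :
  prefix s t -> branch x t -> branch x s.
Proof.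
rewrite prefixE => /eqP <- [k _ <-]; exists (minn (size s) k) => //.
by rewrite /mkseq -map_take take_iota.
Qed.

Lemma branch_le {m} (x : nat -> 'I_m) s t :
  branch x s -> branch x t -> size s <= size t -> prefix s t.
Proof. by move=> /branchE <- /branchE <-; rewrite !size_mkseq; exact: prefix_mkseq. Qed.

Lemma branch_rcons {m} (x : nat -> 'I_m) s :
  branch x s -> branch x (rcons s (x (size s))).
Proof. by move=> /branchE {1}<-; rewrite -mkseqS; exact: branch_mkseq. Qed.

(** A common node longer than [s] would extend both [rcons s i] and [rcons s j]. *)
Lemma branch_meet {m} (x y : nat -> 'I_m) (s u : seq 'I_m) i j : i != j ->
  branch x (rcons s i) -> branch y (rcons s j) ->
  branch x u -> branch y u -> prefix u s.
Proof.
move=> ij xs ys xu yu; have [us|su] := leqP (size u) (size s).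
  by apply: (branch_le xu) us; exact: branch_prefix (prefix_rcons _ _) xs.
have := branch_le xs xu; have := branch_le ys yu.
rewrite !size_rcons !prefixE !size_rcons => /(_ su) /eqP -> /(_ su) /eqP.
by move=> /rcons_inj [ji]; rewrite ji eqxx in ij.
Qed.

Lemma branch_neq {m} (x y : nat -> 'I_m) : x <> y ->
  exists k, forall u, branch x u -> branch y u -> size u < k.
Proof.
move=> xy; have [k xyk] : exists k, x k <> y k.
  by apply: contrapT => /forallNP H; apply: xy; apply/funext => k; apply: contrapT.
exists k.+1 => u /branchE xu /branchE yu; rewrite ltnS leqNgt; apply/negP => ku.
by apply: xyk; rewrite -(nth_mkseq (x k) x ku) -[RHS](nth_mkseq (x k) y ku) xu yu.
Qed.

(** The sets U_x of the idea. Finitely many deleted nodes have bounded length, so cutting off by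
    length still gives a local base at [Branch x]. *)
Definition tail {m} (x : nat -> 'I_m) (l : nat) : set (psi m) :=
  Branch x |` [set Node s | s in [set s | branch x s /\ l <= size s]].

Lemma tail_Node {m} (x : nat -> 'I_m) l s :
  tail x l (Node s) <-> branch x s /\ l <= size s.
Proof. by split=> [[//|[t ? [<-]]]//|?]; right; exists s. Qed.

Lemma tail_Branch {m} (x y : nat -> 'I_m) l : tail x l (Branch y) <-> y = x.
Proof. by split=> [[[]//|[]//]|->]; left. Qed.

Lemma nbhs_Branch {m} (x : nat -> 'I_m) (A : set (psi m)) :
  nbhs (Branch x) A <-> exists l, tail x l `<=` A.
Proof.
split=> [[F /finite_seqP[r ->] FA]|[l lA]].
  exists (\max_(t <- r) size t).+1 => q [->|[s [xs ls] <-]]; apply: FA; first by left.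
  right; exists s => //; split=> // /= sr; move: ls.
  by rewrite ltnNge; apply/negP/negPn; exact: leq_bigmax_seq.
exists [set mkseq x k | k in `I_l]; first exact/finite_image/finite_II.
move=> q [->|[s [xs Fs] <-]]; apply: lA; first by left.
apply/tail_Node; split=> //; rewrite leqNgt; apply/negP => sl; apply: Fs.
by exists (size s) => //; exact/branchE.
Qed.

Lemma nbhs_Node {m} (s : seq 'I_m) (A : set (psi m)) : A (Node s) -> nbhs (Node s) A.
Proof. by move=> As; apply/principal_filterP. Qed.

Lemma tail_closed {m} (x : nat -> 'I_m) l : closed (tail x l).
Proof.
rewrite -[tail x l]setCK; apply: open_closedC; rewrite openE => -[s|y] xp.
  exact: nbhs_Node.
apply/nbhs_Branch; have /branch_neq[k xyk] : x <> y by move=> xy; apply: xp; left; rewrite xy.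
exists k => q [->//|[s [ys ks] <-]] /tail_Node[xs _].
by have := xyk s xs ys; rewrite ltnNge ks.
Qed.

(** Outside a neighbourhood of [Branch x] only finitely many nodes of the tail remain, so a filter
    not clustering at [Branch x] contains a finite set. *)
Lemma tail_compact {m} (x : nat -> 'I_m) l : compact (tail x l).
Proof.
move=> F FF Fx; have [xF|] := pselect (cluster F (Branch x)).
  by exists (Branch x); split=> //; left.
move=> /existsNP[G /existsNP[V /not_implyP[FG /not_implyP[/nbhs_Branch[k kV] GV]]]].
have FGx : F (tail x l `&` G) by apply: filterI.
have fin : finite_set (tail x l `&` G).
  apply: (@sub_finite_set _ _ [set Node (mkseq x j) | j in `I_k]); last first.
    exact/finite_image/finite_II.
  move=> q [[->|[s [xs ls] <-]] Gq].
    by case: GV; exists (Branch x); split=> //; apply: kV; left.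
  exists (size s); last by move/branchE: xs => ->.
  rewrite /= ltnNge; apply/negP => ks; case: GV; exists (Node s); split=> //.
  exact/kV/tail_Node.
by have [p [[px _] pF]] := finite_compact fin FF FGx; exists p.
Qed.

(** Otherwise [C] contains nodes [t k] above z|k and off B(z). They cluster nowhere: growing lengths
    exclude a node, being off B(z) excludes [Branch z], and any other branch leaves z at a finite
    stage. *)
Lemma compact_escape {n} (C : set (psi n)) (z : nat -> 'I_n) : compact C ->
  exists k, forall t, prefix (mkseq z k) t -> C (Node t) -> branch z t.
Proof.
move=> Cc; apply: contrapT => /forallNP H.
have /choice[t tP] : forall k, exists t,
    [/\ prefix (mkseq z k) t, C (Node t) & ~ branch z t].
  by move=> k; have /existsNP[t /not_implyP[zt /not_implyP[Ct nzt]]] := H k; exists t.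
have size_t k : k <= size (t k).
  by have [/size_prefix] := tP k; rewrite size_mkseq.
have evt k : ((fun j => Node (t j)) @ \oo) [set Node (t j) | j in [set j | k <= j]].
  by exists k => // j /= kj; exists j.
have [|p [_]] := Cc ((fun j => Node (t j)) @ \oo) (fmap_proper_filter _ eventually_filter).
  by exists 0 => // j _ /=; have [] := tP j.
case: p => [s|y] clu.
  have [q [[j /= sj <-] [jE]]] := clu _ [set Node s] (evt (size s).+1) (nbhs_Node erefl).
  by have := leq_trans sj (size_t j); rewrite jE ltnn.
have [yz|/branch_neq[k yzk]] := pselect (y = z).
  have [|q [[j _ <-]]] := clu _ (tail y 0) (evt 0); first by apply/nbhs_Branch; exists 0.
  by move=> /tail_Node[]; rewrite yz; have [] := tP j.
have [|q [[j /= kj <-]]] := clu _ (tail y 0) (evt k); first by apply/nbhs_Branch; exists 0.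
have [zt _ _] := tP j => /tail_Node[yt _].
have := yzk _ (branch_prefix zt yt) (branch_mkseq z j).
by rewrite size_mkseq ltnNge kj.
Qed.

Lemma nbhs_setC_tail {m} (x : nat -> 'I_m) l (q : K m) :
  ~ (Some @` tail x l) q -> nbhs q (~` (Some @` tail x l)).
Proof.
case: q => [p|] xq; last first.
  exists (tail x l); first by split; [exact: tail_compact | exact: tail_closed].
  by move=> q [[p xp <-] [p' xp' [pp']]|-> []//]; apply: xp; rewrite -pp'.
have : nbhs p (~` tail x l).
  apply: open_nbhs_nbhs; split; first exact/closed_openC/tail_closed.
  by move=> xp; apply: xq; exists p.
by apply: filterS => p' xp' [p'' xp'' [pp]]; apply: xp'; rewrite -pp.
Qed.

Lemma continuous_Branch {n m} (f : K n -> K m) z x l : continuous f ->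
  f (Some (Branch z)) = Some (Branch x) ->
  exists k, forall t, branch z t -> k <= size t ->
    (Some @` tail x l) (f (Some (Node t))).
Proof.
move=> fc fz; have : nbhs (f (Some (Branch z))) (Some @` tail x l).
  rewrite fz; apply: one_point_compactification_some_nbhs.
  by apply/nbhs_Branch; exists l.
by move=> /fc /nbhs_Branch[k kf]; exists k => t zt kt; apply: kf; apply/tail_Node.
Qed.

(** Continuity at infinity confines the nodes mapped into the tail to a compact set, to which
    [compact_escape] applies; continuity at [Branch z] gives the converse. *)
Lemma preimage_tail {n m} (f : K n -> K m) z x : continuous f ->
  f (Some (Branch z)) = Some (Branch x) -> f None <> Some (Branch x) ->
  exists k l, forall t, prefix (mkseq z k) t ->
    (Some @` tail x l) (f (Some (Node t))) <-> branch z t.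
Proof.
move=> fc fz fx.
have [l lP] : exists l, ~ (Some @` tail x l) (f None).
  case: (f None) fx => [[u|y] fx|_]; last by exists 0 => -[].
  - by exists (size u).+1 => -[p + [pu]]; rewrite pu => /tail_Node[_]; rewrite ltnn.
  - by exists 0 => -[p + [py]]; rewrite py => /tail_Branch yx; apply: fx; rewrite yx.
have [C [Cc _] CP] := fc _ _ (nbhs_setC_tail lP).
have [k kP] := compact_escape z Cc.
have [j jP] := continuous_Branch l fc fz.
exists (maxn k j), l => t kt; split=> [xt|zt].
  apply: kP; first by apply: prefix_trans kt; apply: prefix_mkseq; exact: leq_maxl.
  apply: contrapT => Ct; have /= := CP (Some (Node t)); apply=> //.
  by left; exists (Node t).
apply: jP => //; move/size_prefix: kt; rewrite size_mkseq; apply: leq_trans.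
exact: leq_maxr.
Qed.

(** Baire category: if every [P c] were nowhere dense, [g] would extend any node to one whose
    branches avoid [P c]; doing this for each code in turn yields a branch in no [P c]. *)
Lemma baire_countable_cover {m} (C : countType) (P : C -> (nat -> 'I_m) -> Prop) :
  0 < m -> (forall x, exists c, P c x) ->
  exists c s, forall s', prefix s s' -> exists2 x, branch x s' & P c x.
Proof.
move=> m0 Pcov; apply: contrapT => H.
have /choice[g gP] : forall cs : C * seq 'I_m, exists s',
    prefix cs.2 s' /\ forall x, branch x s' -> ~ P cs.1 x.
  move=> [c s]; apply: contrapT => /forallNP Hs; apply: H; exists c, s => s' ss'.
  apply: contrapT => nx; apply: (Hs s'); split=> // x xs Px.
  by apply: nx; exists x.
pose a : 'I_m := Ordinal m0.
pose h k s := if unpickle k is Some c then g (c, s) else s.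
have hP k s : prefix s (h k s).
  by rewrite /h; case: unpickle => [c|]; [have [] := gP (c, s) | exact: prefix_refl].
(* The appended letter [a] makes the lengths grow, so the nodes [u k] determine an infinite
   branch. *)
pose fix u k : seq 'I_m := if k is j.+1 then rcons (h j (u j)) a else [::].
have uS k : prefix (u k) (u k.+1) by exact: prefix_trans (hP _ _) (prefix_rcons _ _).
have u_le j k : j <= k -> prefix (u j) (u k).
  move=> /subnKC <-; elim: (k - j) => [|i IH]; first by rewrite addn0 prefix_refl.
  by rewrite addnS; exact: prefix_trans IH (uS _).
have size_u k : k <= size (u k).
  elim: k => // k IH; rewrite size_rcons ltnS (leq_trans IH)//.
  exact/size_prefix.
have nth_prefix (s t : seq 'I_m) i : prefix s t -> i < size s -> nth a t i = nth a s i.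
  by move=> /prefixP[r ->] si; rewrite nth_cat si.
pose x i := nth a (u i.+1) i.
have xu k : branch x (u k).
  apply/branchE; apply: (@eq_from_nth _ a); rewrite size_mkseq// => i iu.
  rewrite nth_mkseq// /x; have [ik|/ltnW ki] := leqP i.+1 k.
    by rewrite (nth_prefix (u i.+1) (u k))// u_le.
  by rewrite (nth_prefix (u k) (u i.+1))// u_le.
have [c Pc] := Pcov x; have [_ /(_ x)] := gP (c, u (pickle c)); apply=> //.
have := xu (pickle c).+1; rewrite /= /h pickleK.
by apply: branch_prefix; exact: prefix_rcons.
Qed.

Lemma no_continuous_surjection {n m} (f : K n -> K m) : 1 < m -> n < m ->
  continuous f -> ~ set_surj [set: K n] [set: K m] f.
Proof.
move=> m1 nm fc fs.
(* Indices [inl] account for images of infinity and of nodes, one [x] at most for each; [inr (r, l)]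
   records the data from [preimage_tail]. *)
pose P (c : option (seq 'I_n) + seq 'I_n * nat) (x : nat -> 'I_m) : Prop :=
  match c with
  | inl o => f (omap Node o) = Some (Branch x)
  | inr (r, l) => exists2 z, f (Some (Branch z)) = Some (Branch x) &
      branch z r /\ forall t, prefix r t ->
        (Some @` tail x l) (f (Some (Node t))) <-> branch z t
  end.
pose i0 : 'I_m := Ordinal (ltnW m1); pose i1 : 'I_m := Ordinal m1.
have Pcov x : exists c, P c x.
  have [fx|fx] := pselect (f None = Some (Branch x)); first by exists (inl None).
  have [[[t|z]|] _ fp] := fs (Some (Branch x)) I; last by [].
    by exists (inl (Some t)).
  have [k [l kl]] := preimage_tail fc fp fx.
  by exists (inr (mkseq z k, l)), z => //; split=> //; exact: branch_mkseq.
have [c [s sP]] := baire_countable_cover (ltnW m1) Pcov.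
have /choice[x xP] (i : 'I_m) : exists x, branch x (rcons s i) /\ P c x.
  by have [x xs Px] := sP _ (prefix_rcons s i); exists x.
case: c {sP} xP => [o|[r l]] /= xP.
  (* A single point has one image, but [x i0] and [x i1] pass through different successors of
     [s]. *)
  have [[s0 fo0] [s1 fo1]] := (xP i0, xP i1).
  have x01 : x i0 = x i1 by apply: Some_inj; move: fo1; rewrite fo0 => -[->].
  have /rcons_inj[] : rcons s i0 = rcons s i1 by
    move/branchE: s0 => <-; move/branchE: s1 => <-; rewrite x01 !size_rcons.
  by [].
have /choice[z zP] (i : 'I_m) : exists z,
    [/\ f (Some (Branch z)) = Some (Branch (x i)), branch z r & forall t, prefix r t ->
        (Some @` tail (x i) l) (f (Some (Node t))) <-> branch z t].
  by have [_ [z fz [zr zt]]] := xP i; exists z.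
pose T t := prefix r t /\ exists u,
  [/\ f (Some (Node t)) = Some (Node u), l <= size u & prefix u s].
have xs i : branch (x i) (rcons s i) by have [] := xP i.
(* The image of [t] lies in the tails of both [x i] and [x j]. These branches differ, so it is a
   node common to both, hence below [s]. *)
have TP t i j : i != j -> prefix r t -> branch (z i) t -> branch (z j) t -> T t.
  move=> ij rt zit zjt; split=> //.
  have [_ _ /(_ _ rt)[_ /(_ zit)[p pi fp]]] := zP i.
  have [_ _ /(_ _ rt)[_ /(_ zjt)[q + fq]]] := zP j.
  have -> : q = p by apply: Some_inj; rewrite fp fq.
  case: p pi fp => [u /tail_Node[xiu lu] fu /tail_Node[xju _]|y].
    by exists u; split=> //; exact: branch_meet ij (xs i) (xs j) xiu xju.
  move=> /tail_Branch -> _ /tail_Branch xij.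
  have := xs j; rewrite -xij => /branchE; have /branchE := xs i.
  by rewrite !size_rcons => -> /rcons_inj[ji]; rewrite ji eqxx in ij.
have Tz t i : T t -> branch (z i) t.
  move=> [rt [u [fu lu us]]]; have [_ _ /(_ _ rt)[+ _]] := zP i; apply.
  exists (Node u) => //; apply/tail_Node; split=> //.
  by apply: branch_prefix (xs i); exact: prefix_trans us (prefix_rcons _ _).
have Tr : T r.
  by apply: (TP r i0 i1) => //; [exact: prefix_refl | have [] := zP i0 | have [] := zP i1].
(* All nodes in [T] lie on [z i0], and far along [z i0] the images are too long to be below [s]. *)
have [b Tb] : exists b, forall t, T t -> size t <= b.
  have [fz _ _] := zP i0; have [b bP] := continuous_Branch (size s).+1 fc fz.
  exists b => t Tt; rewrite leqNgt; apply/negP => /ltnW bt.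
  have [_ [u [fu _ us]]] := Tt; have [p + fp] := bP t (Tz t i0 Tt) bt.
  have -> : p = Node u by apply: Some_inj; rewrite fp fu.
  by move=> /tail_Node[_]; rewrite ltnNge (size_prefix us).
have [|k|k] := @ex_maxnP (fun k => `[< exists2 t, T t & size t = k >]) b.
- by exists (size r); apply/asboolP; exists r.
- by move=> /asboolP[t Tt <-]; exact: Tb.
move=> /asboolP[t Tt <-] tmax.
(* Pigeonhole: the m branches [z i] all pass through [t], which has only n successors. *)
have /existsNP[i /existsNP[j /not_implyP[zij /eqP ij]]] :
    ~ injective (fun i => z i (size t)).
  by move/leq_card; rewrite !card_ord leqNgt nm.
have : T (rcons t (z i (size t))).
  apply: (TP _ i j ij); first by case: Tt => rt _; exact: prefix_trans rt (prefix_rcons _ _).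
    exact/branch_rcons/Tz.
  by rewrite zij; exact/branch_rcons/Tz.
move=> Tta; have := tmax (size t).+1; rewrite ltnn => /(_ _)/negP; apply=> //.
by apply/asboolP; exists (rcons t (z i (size t))) => //; rewrite size_rcons.
Qed.

Theorem corollary2p6 :
  (forall m n : nat, (2 <= m)%N -> (2 <= n)%N -> m <> n ->
     ~ homeomorphic (K m) (K n)) /\
  (forall n m : nat, (2 <= n)%N -> (n < m)%N ->
     ~ exists f : K n -> K m,
         continuous f /\ set_surj [set: K n] [set: K m] f).
Proof.
split=> [m n m2 n2 mn [f [g [fc gc fK gK]]]|n m n2 nm [f [fc fs]]]; last first.
  exact: no_continuous_surjection (leq_trans n2 (ltnW nm)) nm fc fs.
(* Of [f] and [g], take the one going from the smaller index to the larger; the other shows that it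
   is onto. *)
have [lt_mn|lt_nm|//] := ltngtP m n.
  by apply: (no_continuous_surjection n2 lt_mn fc) => y _; exists (g y).
by apply: (no_continuous_surjection m2 lt_nm gc) => x _; exists (f x).
Qed.
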